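(* Let $G$ be a biconnected graph. If all 2.5-connected components of $G$ satisfy Hajós' conjecture, then $G$ satisfies Hajós' conjecture. In particular, every graph satisfies Hajós' conjecture if and only if every 2.5-connected graph satisfies Hajós' conjecture.
   Context: Graphs are finite, may have parallel edges (cycles of length 2 allowed), no loops. For a graph $H$, $m(H)$ is the minimum number of edges whose removal makes $H$ simple. A graph $H$ satisfies Hajós' conjecture if, whenever $H$ is Eulerian, its edge set can be decomposed into at most $\frac12(|V(H)|+m(H)-1)$ cycles (each edge in exactly one cycle). Biconnected: connected and for all pairwise distinct $u,v,w$ there is a $u$-$v$ path avoiding $w$. For biconnected $H$ not a triangle, $(c,uv)\in V(H)\times E(H)$ is a vertex-edge-separator if $H-uv-c$ is disconnected; then it has exactly two components $C_u\ni u,C_v\ni v$. For $a\in\{u,v\}$ with other endpoint $b$, let $H_a=H[V(C_a)\cup\{c\}]$; if $|E(H_a)|\ge2$, the 2.5-split replaces $H$ by $H_a+ac$ and $H[V(C_b)\cup\{c\}]+ba+ac$, where the two new edges $ac$ are (virtual) edges corresponding to each other. $H$ is 2.5-connected if biconnected with no vertex-edge-separator. Applying 2.5-splits until none is possible and then merging (gluing at corresponding virtual edges and deleting them) the resulting triangles as much as possible into cycles gives the 2.5-connected components of $G$, regarded as ordinary graphs. *)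

(* Defs.v *)
From mathcomp Require Import all_boot.
Set Implicit Arguments. Unset Strict Implicit. Unset Printing Implicit Defensive.

Definition graph := (seq nat * seq (nat * nat))%type.

Definition ukey (e : nat * nat) : nat * nat := (minn e.1 e.2, maxn e.1 e.2).

Definition wf (H : graph) : Prop :=
  [/\ uniq H.1, H.1 != [::] &
      forall e, e \in H.2 -> [/\ e.1 \in H.1, e.2 \in H.1 & e.1 != e.2]].

Inductive reach (vs : seq nat) (es : seq (nat * nat)) (x : nat) : nat -> Prop :=
  | reach_refl : x \in vs -> reach vs es x x
  | reach_step y z : reach vs es x y -> z \in vs ->
      ((y, z) \in es \/ (z, y) \in es) -> reach vs es x z.

Definition connected (vs : seq nat) (es : seq (nat * nat)) : Prop :=
  forall x y, x \in vs -> y \in vs -> reach vs es x y.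

Definition biconnected (H : graph) : Prop :=
  connected H.1 H.2 /\
  forall u v w, u \in H.1 -> v \in H.1 -> w \in H.1 ->
    u != v -> u != w -> v != w -> reach [seq x <- H.1 | x != w] H.2 u v.

Definition deg (H : graph) (v : nat) : nat :=
  count (fun e : nat * nat => (e.1 == v) || (e.2 == v)) H.2.
Definition eulerian (H : graph) : Prop := forall v, v \in H.1 -> ~~ odd (deg H v).

(* m(H): minimum number of edges whose removal makes H simple
   = |E| - max number of edges one can keep with no two parallel *)
Definition mpar (H : graph) : nat :=
  size H.2 - \max_(b : (size H.2).-tuple bool | uniq (map ukey (mask b H.2)))
               count id b.

Definition cycle_on (es : seq (nat * nat)) (cs vl : seq nat) : Prop :=
  2 <= size cs /\ uniq cs /\ all (fun i => i < size es) cs /\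
      size vl = size cs /\ uniq vl /\
      (forall j, j < size cs ->
        ukey (nth (0, 0) es (nth 0 cs j)) =
        ukey (nth 0 vl j, nth 0 vl (j.+1 %% size cs))).

Definition is_cycle (es : seq (nat * nat)) (cs : seq nat) : Prop :=
  exists vl, cycle_on es cs vl.

Definition cycle_decomposition (H : graph) (C : seq (seq nat)) : Prop :=
  perm_eq (flatten C) (iota 0 (size H.2)) /\ forall cs, cs \in C -> is_cycle H.2 cs.

(* Hajós' conjecture for H: if Eulerian, decomposable into at most
   (|V| + m(H) - 1)/2 cycles, i.e. 2k <= |V| + m(H) - 1 *)
Definition hajos (H : graph) : Prop :=
  eulerian H -> exists C, cycle_decomposition H C /\ (2 * size C).+1 <= size H.1 + mpar H.

Definition is_cycle_graph (H : graph) : Prop :=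
  exists cs vl, [/\ cycle_on H.2 cs vl, perm_eq cs (iota 0 (size H.2)) & perm_eq vl H.1].

Definition triangle (H : graph) : Prop := is_cycle_graph H /\ size H.1 = 3.

Definition rem_idx {T} (i : nat) (s : seq T) : seq T := take i s ++ drop i.+1 s.

Definition ve_separator (H : graph) (c i : nat) : Prop :=
  [/\ biconnected H, ~ triangle H, c \in H.1, i < size H.2 &
      ~ connected [seq x <- H.1 | x != c] (rem_idx i H.2)].

Definition two5_connected (H : graph) : Prop :=
  biconnected H /\ forall c i, ~ ve_separator H c i.

(* edge ((u,v),t): t = 0 real edge, t = k > 0 : virtual edge of correspondence class k *)
Definition lgraph := (seq nat * seq (nat * nat * nat))%type.
Definition forget (L : lgraph) : graph := (L.1, map fst L.2).

Definition induced (L : lgraph) (X : seq nat) : seq (nat * nat * nat) :=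
  [seq e <- L.2 | (e.1.1 \in X) && (e.1.2 \in X)].

Definition split_at (L : lgraph) (k : nat) (L1 L2 : lgraph) : Prop :=
  let H := forget L in
  biconnected H /\ ~ triangle H /\
  exists c i a b t Ca Cb,
    let vs' := [seq x <- L.1 | x != c] in
    let es' := rem_idx i H.2 in
    ve_separator H c i /\
    (nth ((0, 0), 0) L.2 i = ((a, b), t) \/ nth ((0, 0), 0) L.2 i = ((b, a), t)) /\
    (uniq Ca /\ (forall x, x \in Ca <-> reach vs' es' a x)) /\
    (uniq Cb /\ (forall x, x \in Cb <-> reach vs' es' b x)) /\
    2 <= size (induced L (c :: Ca)) /\
    L1 = (c :: Ca, rcons (induced L (c :: Ca)) ((a, c), k)) /\
    L2 = (a :: c :: Cb,
          induced L (c :: Cb) ++ [:: nth ((0, 0), 0) L.2 i; ((a, c), k)]).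

Definition tag_fresh (S : seq lgraph) (k : nat) : Prop :=
  0 < k /\ forall L e, L \in S -> e \in L.2 -> e.2 != k.

Definition split_step (S S' : seq lgraph) : Prop :=
  exists L rest k L1 L2,
    [/\ perm_eq S (L :: rest), tag_fresh S k, split_at L k L1 L2 &
        S' = L1 :: L2 :: rest].

Definition split_terminal (S : seq lgraph) : Prop :=
  forall L k L1 L2, L \in S -> ~ split_at L k L1 L2.

Definition cyc3 (L : lgraph) : Prop := is_cycle_graph (forget L) /\ 3 <= size L.1.

(* merging two cycles at corresponding virtual edges e1, e2 (tag k):
   the vertices of L2 are renamed by f, the endpoints of e2 are identified
   with those of e1, all other vertices of L2 become new; e1, e2 are deleted *)
Definition merge_at (L1 L2 L3 : lgraph) : Prop :=
  cyc3 L1 /\ cyc3 L2 /\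
  exists e1 e2 (f : nat -> nat),
    e1 \in L1.2 /\ e2 \in L2.2 /\ 0 < e1.2 /\ e1.2 = e2.2 /\
    {in L2.1 &, injective f} /\
    ((f e2.1.1, f e2.1.2) = e1.1 \/ (f e2.1.2, f e2.1.1) = e1.1) /\
    (forall x, x \in L2.1 -> x \notin [:: e2.1.1; e2.1.2] -> f x \notin L1.1) /\
    L3 = (L1.1 ++ [seq f x | x <- L2.1 & x \notin [:: e2.1.1; e2.1.2]],
          rem e1 L1.2 ++ [seq ((f e.1.1, f e.1.2), e.2) | e <- rem e2 L2.2]).

Definition merge_step (S S' : seq lgraph) : Prop :=
  exists L1 L2 L3 rest,
    [/\ perm_eq S (L1 :: L2 :: rest), merge_at L1 L2 L3 & S' = L3 :: rest].

Definition merge_terminal (S : seq lgraph) : Prop :=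
  forall L1 L2 rest e1 e2, perm_eq S (L1 :: L2 :: rest) -> cyc3 L1 -> cyc3 L2 ->
    e1 \in L1.2 -> e2 \in L2.2 -> 0 < e1.2 -> e1.2 != e2.2.

Inductive star (R : seq lgraph -> seq lgraph -> Prop) (S : seq lgraph) :
    seq lgraph -> Prop :=
  | star_refl : star R S S
  | star_step S1 S2 : star R S S1 -> R S1 S2 -> star R S S2.

Definition init_state (G : graph) : seq lgraph :=
  [:: (G.1, [seq (e, 0) | e <- G.2])].

Definition two5_components (G : graph) (F : seq graph) : Prop :=
  exists S T,
    [/\ star split_step (init_state G) S, split_terminal S,
        star merge_step S T, merge_terminal T & F = map forget T].

(* Main.v *)
Require Import Defs.
From mathcomp Require Import all_boot zify.
From Stdlib Require Import Classical.

(** A 2.5-split at [(c, ab)] writes [G] as a 2-sum of [G1 = A + ac] and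
    [G2 = B + ab + ac] along the virtual edge [ac]. If [G] is Eulerian then so are
    [G1] and [G2], by parity of the degrees. In decompositions of [G1] and [G2] into
    [k1] and [k2] cycles, the two cycles through [ac] are glued into one, so [G] has a
    decomposition into [k1 + k2 - 1] cycles. Since [|V(G1)| + |V(G2)| = |V(G)| + 2] and
    [m(G1) + m(G2) <= m(G) + 1] (only [ac] may become parallel to an edge of [A]), the
    bounds for [G1] and [G2] add up to the bound for [G]. Merging only ever involves
    cycles of length at least 3, which satisfy the conjecture.
    For the equivalence, induct on [|V| + |E|]: a graph that is not biconnected is cut
    at a vertex (or between components), a biconnected one is 2.5-split; a split is
    possible on neither side only if both sides have at most one edge, in which case an
    Eulerian [G] is a triangle. *)

Set Implicit Arguments. Unset Strict Implicit. Unset Printing Implicit Defensive.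

(** * Unordered edges and incidence *)

Definition incident (v : nat) (e : nat * nat) := (e.1 == v) || (e.2 == v).

Lemma ukeyC x y : ukey (x, y) = ukey (y, x).
Proof. by rewrite /ukey /= minnC maxnC. Qed.

Lemma ukey_eqP e x y : ukey e = ukey (x, y) -> e = (x, y) \/ e = (y, x).
Proof.
case: e => u v; rewrite /ukey /= => -[h1 h2].
have [[-> ->]|[-> ->]] : (u = x /\ v = y) \/ (u = y /\ v = x) by lia.
- by left.
- by right.
Qed.

Lemma incident_ukey v e : incident v (ukey e) = incident v e.
Proof.
by case: e => x y; rewrite /incident /ukey /=; case: (leqP x y) => // _; rewrite orbC.
Qed.

Lemma count_incident_ukey v (E : seq (nat * nat)) :
  count (incident v) (map ukey E) = count (incident v) E.
Proof. by rewrite count_map; apply: eq_count => e /=; rewrite incident_ukey. Qed.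

Lemma count_incident0 (X : seq nat) v (E : seq (nat * nat)) :
  (forall e, e \in E -> e.1 \in X /\ e.2 \in X) -> v \notin X ->
  count (incident v) E = 0.
Proof.
move=> EX vX; apply/eqP; rewrite -leqn0 leqNgt -has_count; apply/hasPn => e /EX[e1 e2].
by rewrite /incident negb_or; apply/andP; split; apply: contraNneq vX => <-.
Qed.

(** * Parallel classes and [m(H)] *)

Definition num_distinct (E : seq (nat * nat)) := size (undup (map ukey E)).
Local Notation nd := num_distinct.

Lemma nd_size E : nd E <= size E.
Proof. by rewrite -(size_map ukey) size_undup. Qed.

Lemma nd_sub E E' : {subset map ukey E <= map ukey E'} -> nd E <= nd E'.
Proof.
move=> sub; apply: uniq_leq_size (undup_uniq _) _ => x.
by rewrite !mem_undup; apply: sub.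
Qed.

Lemma nd_cat E E' : nd (E ++ E') <= nd E + nd E'.
Proof.
rewrite /nd -size_cat; apply: uniq_leq_size (undup_uniq _) _ => x.
by rewrite mem_cat !mem_undup map_cat mem_cat.
Qed.

Lemma nd_cons e E : ukey e \notin map ukey E -> nd (e :: E) = (nd E).+1.
Proof. by rewrite /nd /= => /negbTE->. Qed.

(** A set of pairwise non-parallel edges has at most one edge from each parallel class, and [undup]
    selects exactly one, so the maximum in [mpar] is the number of classes. *)
Lemma mparE H : mpar H = size H.2 - nd H.2.
Proof.
case: H => V E; rewrite /mpar /=; congr (_ - _); apply/eqP; rewrite eqn_leq; apply/andP; split.
  apply/bigmax_leqP => b ub.
  rewrite -(size_mask (size_tuple b)) -(size_map ukey).
  apply: uniq_leq_size => // x; rewrite mem_undup => /mapP[e /mem_mask eE ->].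
  exact: map_f.
have /subseqP[m sm eqm] := undup_subseq (map ukey E).
move: sm; rewrite size_map => sm.
have sm' : size m == size E by rewrite sm.
rewrite /nd eqm size_mask ?size_map //.
apply: (leq_trans _ (leq_bigmax_cond (Tuple sm') _)) => //=.
by rewrite map_mask -eqm undup_uniq.
Qed.

(** * Cycles as closed vertex sequences *)

Definition path_edges (x : nat) (p : seq nat) := pairmap (fun y z => ukey (y, z)) x p.
(** For two vertices the same unordered pair is listed twice, which matches a cycle formed by two
    parallel edges. *)
Definition cycle_edges (vl : seq nat) :=
  if vl is x :: p then path_edges x (rcons p x) else [::].

Lemma size_cycle_edges vl : size (cycle_edges vl) = size vl.
Proof. by case: vl => //= x p; rewrite size_pairmap size_rcons. Qed.

Lemma nth_cycle_edges vl j : j < size vl ->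
  nth (0, 0) (cycle_edges vl) j = ukey (nth 0 vl j, nth 0 vl (j.+1 %% size vl)).
Proof.
case: vl => // x p jp; rewrite /cycle_edges /path_edges.
rewrite (nth_pairmap 0) ?size_rcons // -rcons_cons nth_rcons jp nth_rcons.
congr (ukey (_, _)); move: jp; rewrite /= ltnS leq_eqVlt => /orP[/eqP->|jp].
  by rewrite ltnn eqxx modnn.
by rewrite jp modn_small.
Qed.

Lemma cycle_onE es cs vl :
  cycle_on es cs vl <->
  [/\ 2 <= size vl, uniq vl, uniq cs, all (fun i => i < size es) cs &
      [seq ukey (nth (0, 0) es i) | i <- cs] = cycle_edges vl].
Proof.
split=> [[s2 [ucs [acs [svl [uvl nthE]]]]]|[s2 uvl ucs acs eqE]].
  split=> //; first by rewrite svl.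
  apply: (@eq_from_nth _ (0, 0)); first by rewrite size_map size_cycle_edges.
  move=> j; rewrite size_map => jc.
  by rewrite (nth_map 0) // nthE // nth_cycle_edges svl.
have svl : size vl = size cs by rewrite -size_cycle_edges -eqE size_map.
split; first by rewrite -svl.
do 4 split=> //.
move=> j jc; rewrite -svl -nth_cycle_edges ?svl // -eqE (nth_map 0) //.
Qed.

Definition simple_closed (vl : seq nat) := (2 <= size vl) && uniq vl.

Definition decomposable (E : seq (nat * nat)) (k : nat) : Prop :=
  exists2 VL, size VL = k /\ all simple_closed VL &
    perm_eq (flatten (map cycle_edges VL)) (map ukey E).

Lemma uniq_flatten_mem (T : eqType) (C : seq (seq T)) s :
  uniq (flatten C) -> s \in C -> uniq s.
Proof.
elim: C => //= t C IH; rewrite cat_uniq inE => /and3P[ut _ uC] /orP[/eqP->//|].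
exact: IH.
Qed.

Lemma decomposable_cycles H k :
  (exists2 C, cycle_decomposition H C & size C = k) <-> decomposable H.2 k.
Proof.
case: H => V E /=; split.
  case=> C [permC cycC] <- {k}.
  have [VL [sVL aVL eqVL]] : exists VL, [/\ size VL = size C, all simple_closed VL &
      map cycle_edges VL = [seq [seq ukey (nth (0, 0) E i) | i <- cs] | cs <- C]].
    elim: C cycC {permC} => [|cs C IH] cycC; first by exists [::].
    have [|VL [sVL aVL eqVL]] := IH; first by move=> d dC; apply: cycC; rewrite inE dC orbT.
    have [vl /cycle_onE[s2 uvl _ _ eqE]] := cycC cs (mem_head _ _).
    exists (vl :: VL); split=> /=; first by rewrite sVL.
      by rewrite aVL andbT; apply/andP.
    by rewrite eqVL eqE.
  exists VL => //; rewrite eqVL -map_flatten.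
  apply: perm_trans (perm_map _ permC) _ => /=.
  rewrite (map_comp ukey (nth (0, 0) E)) -/(mkseq (nth (0, 0) E) (size E)).
  by rewrite mkseq_nth.
case=> VL [<- {k} aVL] permVL.
(* Indices are recovered from the equality of multisets: [Is] lists the edge indices in the order in
   which the cycles use them, and cutting it into blocks of the cycle lengths gives the index
   cycles. *)
have [Is permI eqI] := perm_iotaP (0, 0) permVL.
rewrite size_map in permI.
pose C := reshape (map size VL) Is.
have shE : shape (map cycle_edges VL) = map size VL.
  by rewrite /shape -map_comp; apply: eq_map => vl /=; rewrite size_cycle_edges.
have sI : sumn (map size VL) = size Is.
  by rewrite -(size_map (nth (0, 0) (map ukey E)) Is) -eqI size_flatten shE.
have flC : flatten C = Is by rewrite /C reshapeKr ?sI.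
have mapC : map (map (nth (0, 0) (map ukey E))) C = map cycle_edges VL.
  by rewrite /C map_reshape -eqI -shE flattenK.
exists C; last by rewrite -(size_map (map (nth (0, 0) (map ukey E)))) mapC size_map.
split; first by rewrite flC.
move=> cs csC.
have uI : uniq Is by rewrite (perm_uniq permI) iota_uniq.
have sub : {subset cs <= Is} by move=> i ics; rewrite -flC; apply/flattenP; exists cs.
have bI i : i \in cs -> i < size E by move/sub; rewrite (perm_mem permI) mem_iota.
have /mapP[vl vlV eqvl] : map (nth (0, 0) (map ukey E)) cs \in map cycle_edges VL.
  by rewrite -mapC; apply: map_f.
exists vl; apply/cycle_onE; have /andP[s2 uvl] := allP aVL _ vlV.
split=> //; last 2 first.
- by apply/allP => i; apply: bI.
- rewrite -eqvl; apply/eq_in_map => i /bI iE.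
  by rewrite (nth_map (0, 0)).
by rewrite -flC in uI; apply: uniq_flatten_mem uI csC.
Qed.

(** The bound free of subtraction: the difference in [mparE] is never truncated, by [nd_size]. *)
Lemma hajosE H :
  hajos H <->
  (eulerian H -> exists2 k, decomposable H.2 k &
    (2 * k).+1 + nd H.2 <= size H.1 + size H.2).
Proof.
have ndE := nd_size H.2; rewrite /hajos mparE; split=> hH eH.
  have [C [dC le]] := hH eH; exists (size C); last by lia.
  by apply/decomposable_cycles; exists C.
have [k /decomposable_cycles[C dC sC] le] := hH eH.
by exists C; split=> //; rewrite sC; lia.
Qed.

Lemma decomposable_perm E E' k :
  perm_eq (map ukey E) (map ukey E') -> decomposable E k -> decomposable E' k.
Proof. by move=> pE [VL sVL pVL]; exists VL => //; apply: perm_trans pE. Qed.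

Lemma decomposable_cat E E' k k' :
  decomposable E k -> decomposable E' k' -> decomposable (E ++ E') (k + k').
Proof.
move=> [VL [<- aVL] pVL] [VL' [<- aVL'] pVL']; exists (VL ++ VL').
  by rewrite size_cat all_cat aVL.
by rewrite !map_cat flatten_cat perm_cat.
Qed.

(** * Opening cycles at an edge and gluing them *)

Lemma path_edges_cat x s1 s2 :
  path_edges x (s1 ++ s2) = path_edges x s1 ++ path_edges (last x s1) s2.
Proof. exact: pairmap_cat. Qed.

Lemma last_rev_belast (T : Type) (x : T) p : last (last x p) (rev (belast x p)) = x.
Proof. by case: p => //= y p; rewrite rev_cons last_rcons. Qed.

Lemma path_edges_rev x p :
  perm_eq (path_edges (last x p) (rev (belast x p))) (path_edges x p).
Proof.
elim: p x => //= y p IH x.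
rewrite rev_cons -cats1 path_edges_cat last_rev_belast /= cats1 perm_rcons ukeyC perm_cons.
exact: IH.
Qed.

Lemma mem_path_edges z x s : z \in path_edges x s ->
  exists s1 y s2, s = s1 ++ y :: s2 /\ z = ukey (last x s1, y).
Proof.
elim: s x => //= w s IH x; rewrite inE => /orP[/eqP->|/IH[s1 [y [s2 [-> ->]]]]].
  by exists [::], w, s.
by exists (w :: s1), y, s2.
Qed.

Lemma incident_path_edges z x p : z \in p -> has (incident z) (path_edges x p).
Proof.
elim: p x => //= y p IH x; rewrite inE => /orP[/eqP->|/IH->]; last by rewrite orbT.
by rewrite incident_ukey /incident /= eqxx orbT.
Qed.

(** The cycle is rotated until the chosen edge closes it; if the remaining path then runs from [c]
    to [a], it is reversed. *)
Lemma cycle_open vl a c : uniq vl -> ukey (a, c) \in cycle_edges vl ->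
  exists p, [/\ uniq (a :: p), last a p = c &
    perm_eq (cycle_edges vl) (ukey (a, c) :: path_edges a p)].
Proof.
move=> uvl acE.
have [y [p [up eqac pE]]] : exists y p, [/\ uniq (y :: p),
    ukey (last y p, y) = ukey (a, c) &
    perm_eq (cycle_edges vl) (ukey (a, c) :: path_edges y p)].
  case: vl uvl acE => // x p uxp /mem_path_edges[s1 [y [s2 [eqp ->]]]].
  (* If nothing follows [y], the edge already closes the list; otherwise the list is rotated to
     start at [y]. *)
  case/lastP: s2 eqp => [|s2 w] eqp.
    move: eqp uxp; rewrite cats1 => /rcons_inj[<- <-] uxp; exists x, p; split=> //=.
    by rewrite -cats1 path_edges_cat cats1 perm_rcons.
  move: eqp uxp; rewrite -rcons_cons -rcons_cat => /rcons_inj[-> _] uxp.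
  exists y, (s2 ++ x :: s1); split; last 1 first.
  - rewrite /= -cats1 -catA /= !path_edges_cat /= path_edges_cat /=.
    by apply/permP => P; rewrite !count_cat /= !count_cat /=; lia.
  - by rewrite -cat_cons uniq_catC.
  - by rewrite last_cat.
have [[la yc]|[lc ya]] := ukey_eqP eqac; last by exists p; subst y; split.
exists (rev (belast y p)); split.
- by rewrite -la -rev_rcons -lastI rev_uniq.
- by rewrite -la -yc last_rev_belast.
- by apply: perm_trans pE _; rewrite perm_cons perm_sym -{1}la path_edges_rev.
Qed.

Lemma cycle_through E k a c : decomposable ((a, c) :: E) k ->
  exists p VL, [/\ uniq (a :: p), last a p = c, k = (size VL).+1, all simple_closed VL &
    perm_eq (path_edges a p ++ flatten (map cycle_edges VL)) (map ukey E)].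
Proof.
case=> VL [<- aVL] pVL.
have : ukey (a, c) \in flatten (map cycle_edges VL) by rewrite (perm_mem pVL) mem_head.
case/flattenP => _ /mapP[vl vlV ->] acE.
have /andP[_ uvl] := allP aVL _ vlV.
have [p [up lp pE]] := cycle_open uvl acE.
have pV := perm_to_rem vlV.
exists p, (rem vl VL); split=> //; first by rewrite (perm_size pV).
  by move: aVL; rewrite (perm_all _ pV) => /andP[].
rewrite -(perm_cons (ukey (a, c))); apply: perm_trans pVL.
rewrite perm_sym; apply: perm_trans (perm_flatten (perm_map _ pV)) _.
by rewrite /= -cat_cons perm_cat2r.
Qed.

(** In each decomposition the cycle through [ac] loses that edge and becomes an [a]-[c] path. By
    [disj] the two paths share only their ends, so together they form one cycle, and all other
    cycles are kept. *)
Lemma decomposable_two_sum E1 E2 k1 k2 a c : a != c ->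
  (forall x, has (incident x) E1 -> has (incident x) E2 -> (x == a) || (x == c)) ->
  decomposable ((a, c) :: E1) k1 -> decomposable ((a, c) :: E2) k2 ->
  decomposable (E1 ++ E2) (k1 + k2).-1.
Proof.
move=> nac disj /cycle_through[p1 [VL1 [u1 l1 -> a1 pm1]]].
case/cycle_through=> p2 [VL2 [u2 l2 -> a2 pm2]].
case: p2 => [|y q] in u2 l2 pm2; first by move: nac; rewrite -l2 eqxx.
have incE E p VL x : perm_eq (path_edges a p ++ flatten (map cycle_edges VL)) (map ukey E) ->
    x \in p -> has (incident x) E.
  move=> pm /(incident_path_edges a) h; rewrite has_count -count_incident_ukey -(permP pm).
  by rewrite -has_count has_cat h.
(* [belast y q] consists of the inner vertices of the second path, which is followed backwards from
   [c] to [a]. *)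
exists ((a :: p1 ++ rev (belast y q)) :: VL1 ++ VL2).
  split; first by rewrite /= size_cat; lia.
  rewrite /= all_cat a1 a2 !andbT; apply/andP; split.
    by case: p1 l1 {u1 pm1} => // ac; rewrite -ac eqxx in nac.
  rewrite -cat_cons cat_uniq u1 rev_uniq.
  have : uniq (a :: rcons (belast y q) c) by rewrite -l2 /= -lastI.
  rewrite /= mem_rcons inE negb_or rcons_uniq => /and3P[/andP[_ aq] cq uq].
  rewrite uq andbT; apply/hasPn => z; rewrite mem_rev => zq; apply/negP.
  rewrite inE => /orP[/eqP za|zp1]; first by rewrite -za zq in aq.
  have zq' : z \in y :: q by rewrite lastI mem_rcons inE zq orbT.
  have := disj z (incE _ _ _ _ pm1 zp1) (incE _ _ _ _ pm2 zq').
  by case/orP=> /eqP ez; [rewrite -ez zq in aq | rewrite -ez zq in cq].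
rewrite /= map_cat flatten_cat rcons_cat path_edges_cat l1.
have -> : rcons (rev (belast y q)) a = rev (belast a (y :: q)) by rewrite /= rev_cons.
rewrite -{1}l2 map_cat; apply: perm_trans (perm_cat pm1 pm2); apply/permP => P.
by rewrite !count_cat (permP (path_edges_rev _ _)); lia.
Qed.

(** * Parity of degrees *)

Lemma sum_incident V e : uniq V -> e.1 \in V -> e.2 \in V -> e.1 != e.2 ->
  \sum_(v <- V) incident v e = 2.
Proof.
move=> uV e1 e2 ne.
transitivity (count_mem e.1 V + count_mem e.2 V); last by rewrite !count_uniq_mem // e1 e2.
rewrite -!sum1_count [in RHS]big_mkcond [X in _ + X]big_mkcond -big_split /=.
apply: eq_bigr => v _; rewrite /incident ![v == _]eq_sym.
by case: eqP => [<-|_]; [rewrite eq_sym (negbTE ne) | case: eqP].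
Qed.

Lemma handshake H : wf H -> \sum_(v <- H.1) deg H v = 2 * size H.2.
Proof.
case: H => V E [/= uV _ hE]; rewrite /deg /=.
elim: E hE => [|e E IH] hE /=; first by rewrite big1.
rewrite big_split /= IH => [|f fE]; last by apply: hE; rewrite inE fE orbT.
have [e1 e2 ne] := hE e (mem_head _ _).
by rewrite (sum_incident uV e1 e2 ne) mulnS.
Qed.

(** The degree sum is even, so parity at the last vertex is forced. This spares the cut vertex,
    whose degree is shared between the two sides in an unknown way. *)
Lemma eulerian_but_one H c : wf H ->
  (forall x, x \in H.1 -> x != c -> ~~ odd (deg H x)) -> eulerian H.
Proof.
move=> wH ev v vH; have [vc|] := eqVneq v c; last exact: ev.
have [uV _ _] := wH.
have := handshake wH; rewrite (big_rem v vH) /= => hs.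
have : ~~ odd (\sum_(y <- rem v H.1) deg H y).
  rewrite big_seq; apply: (big_ind (fun n => ~~ odd n)) => // [m n|y].
    by rewrite oddD => /negbTE-> /negbTE->.
  by rewrite mem_rem_uniq // inE /= => /andP[yv yH]; apply: ev; rewrite // -vc.
by move: (congr1 odd hs); rewrite oddM oddD /=; do 2!case: odd.
Qed.

Lemma degE V E v : deg (V, E) v = count (incident v) E.
Proof. by []. Qed.

(** * Reachability *)

Lemma reach_mem vs es x y : reach vs es x y -> x \in vs /\ y \in vs.
Proof. by elim=> // {}y z _ [xv _] zv _. Qed.

Lemma reach_trans vs es x y z : reach vs es x y -> reach vs es y z -> reach vs es x z.
Proof. by move=> xy; elim=> // z1 z2 _ IH z2v e; apply: reach_step IH z2v e. Qed.

Lemma reach_sym vs es x y : reach vs es x y -> reach vs es y x.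
Proof.
elim=> [xv|{}y z xy yx zv e]; first exact: reach_refl.
apply: reach_trans yx; have [_ yv] := reach_mem xy.
by apply: reach_step (reach_refl _ zv) yv _; case: e; [right | left].
Qed.

(** A set of reached vertices grows by one neighbour at a time; this stops because the set stays
    inside the finite [vs], and a closed set contains everything reachable. *)
Lemma reach_set vs es x :
  exists R, uniq R /\ forall y, y \in R <-> reach vs es x y.
Proof.
have [xv|xNv] := boolP (x \in vs); last first.
  by exists [::]; split=> // y; split=> // /reach_mem[]; rewrite (negbTE xNv).
have grow n (R : seq nat) : size (undup vs) - size R < n -> uniq R -> x \in R ->
    (forall y, y \in R -> reach vs es x y) ->
    exists R, uniq R /\ forall y, y \in R <-> reach vs es x y.
  elim: n R => // n IH R sR uR xR hR.
  have [/hasP[z zv /andP[zR /hasP[y yR yz]]]|/hasPn clos] :=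
      boolP (has (fun z => (z \notin R) &&
               has (fun y => ((y, z) \in es) || ((z, y) \in es)) R) vs).
    have rz : reach vs es x z by apply: reach_step (hR _ yR) zv _; apply/orP.
    have hR' w : w \in z :: R -> reach vs es x w.
      by rewrite inE => /orP[/eqP->//|]; apply: hR.
    have uR' : uniq (z :: R) by rewrite /= zR.
    have sR' : size R < size (undup vs).
      by apply: (uniq_leq_size uR') => w /hR' /reach_mem[]; rewrite mem_undup.
    apply: (IH (z :: R)) => //=; last by rewrite inE xR orbT.
    by move: sR sR'; set N := size (undup vs); set m := size R; clearbody N m; lia.
  exists R; split=> // y; split; first exact: hR.
  elim=> // {}y z _ yR zv e; apply/negPn/negP => zR.
  by case/negP: (clos z zv); rewrite zR; apply/hasP; exists y => //; apply/orP.
apply: (grow _ [:: x] (ltnSn _)) => //; first exact: mem_head.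
by move=> y; rewrite inE => /eqP->; apply: reach_refl.
Qed.

(** * The 2.5-split and its effect on the bound *)

(* [A] and [B] are the two sides [G[Ca + c]] and [G[Cb + c]], and [e0] joins [a] to [b]. *)
Record ve_split (G : graph) (a b c : nat) (Ca Cb : seq nat) (e0 : nat * nat)
    (A B : seq (nat * nat)) : Prop := VeSplit {
  split_uniq : uniq (c :: Ca ++ Cb);
  split_vertices : perm_eq G.1 (c :: Ca ++ Cb);
  split_edges : perm_eq G.2 (e0 :: A ++ B);
  split_edge : ukey e0 = ukey (a, b);
  split_a : a \in Ca;
  split_b : b \in Cb;
  split_wfA : wf (c :: Ca, A);
  split_wfB : wf (c :: Cb, B) }.

(** The record is symmetric although the 2.5-split is not, so either side may be taken as the one
    that gives up [e0]. *)
Lemma ve_split_sym G a b c Ca Cb e0 A B :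
  ve_split G a b c Ca Cb e0 A B -> ve_split G b a c Cb Ca e0 B A.
Proof.
case=> u pV pE e0E aC bC wA wB; split=> //.
- by move: u; rewrite /= !mem_cat orbC uniq_catC.
- by apply: perm_trans pV _; rewrite perm_cons perm_catC.
- by apply: perm_trans pE _; rewrite perm_cons perm_catC.
- by rewrite e0E ukeyC.
Qed.

Section VeSplit.
Variables (G : graph) (a b c : nat) (Ca Cb : seq nat) (e0 : nat * nat).
Variables (A B : seq (nat * nat)).
Hypothesis spl : ve_split G a b c Ca Cb e0 A B.

Let G1 : graph := (c :: Ca, rcons A (a, c)).
Let G2 : graph := (a :: c :: Cb, B ++ [:: e0; (a, c)]).

Lemma ve_split_notin :
  [/\ c \notin Ca, c \notin Cb, {in Ca, forall x, x \notin c :: Cb} &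
      {in Cb, forall x, x \notin c :: Ca}].
Proof.
have [/= /andP[]] := spl; rewrite mem_cat negb_or => /andP[cA cB].
rewrite cat_uniq => /and3P[_ /hasPn disj _] _ _ _ _ _ _ _.
split=> // x xC; rewrite inE negb_or; apply/andP; split.
- by apply: contraNneq cA => <-.
- by apply/negP => /disj; rewrite xC.
- by apply: contraNneq cB => <-.
- exact: disj.
Qed.

Lemma ve_split_neq : [/\ a != c, b != c & a != b].
Proof.
have [cA cB AB BA] := ve_split_notin; have aC := split_a spl; have bC := split_b spl.
split; [by apply: contraNneq cA => <- | by apply: contraNneq cB => <- |].
by apply: contraTneq aC => ->; have := BA _ bC; rewrite inE negb_or => /andP[].
Qed.

Lemma ve_split_e0 x : incident x e0 = (a == x) || (b == x).
Proof. by rewrite -incident_ukey (split_edge spl) incident_ukey. Qed.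

Lemma ve_split_deg x : deg G x = (incident x e0 + count (incident x) A) + count (incident x) B.
Proof. by rewrite /deg (permP (split_edges spl)) /= count_cat addnA. Qed.

Lemma ve_split_countA x : x \notin c :: Ca -> count (incident x) A = 0.
Proof.
by apply: count_incident0 => e eA; have [_ _ /(_ e eA)[]] := split_wfA spl.
Qed.

Lemma ve_split_countB x : x \notin c :: Cb -> count (incident x) B = 0.
Proof.
by apply: count_incident0 => e eB; have [_ _ /(_ e eB)[]] := split_wfB spl.
Qed.

Lemma ve_split_wf1 : wf G1.
Proof.
have [nac _ _] := ve_split_neq; have [uA _ hA] := split_wfA spl.
split=> // e; rewrite mem_rcons inE => /orP[/eqP->|/hA//].
by split=> //=; rewrite inE ?eqxx // (split_a spl) orbT.
Qed.

Lemma ve_split_wf2 : wf G2.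
Proof.
have [nac nbc nab] := ve_split_neq; have [uB _ hB] := split_wfB spl.
have [_ _ AB _] := ve_split_notin.
have bV : b \in a :: c :: Cb by rewrite !inE (split_b spl) !orbT.
have aV : a \in a :: c :: Cb by rewrite mem_head.
have cV : c \in a :: c :: Cb by rewrite !inE eqxx orbT.
split=> //; first by rewrite cons_uniq AB ?(split_a spl).
move=> e; rewrite mem_cat => /orP[/hB[e1 e2 ne]|].
  by split=> //; rewrite in_cons ?e1 ?e2 orbT.
rewrite !inE => /orP[/eqP->|/eqP->]; last by split.
by have [->|->] := ukey_eqP (split_edge spl); split=> //=; rewrite eq_sym.
Qed.

(** Inside [Ca] both [e0] and the virtual edge [ac] are incident with [a] only, so replacing one by
    the other keeps all degrees there. *)
Lemma ve_split_eulerian1 : eulerian G -> eulerian G1.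
Proof.
move=> eG; apply: (eulerian_but_one (c := c)) ve_split_wf1 _ => x.
rewrite inE => /orP[/eqP->|xA xc]; first by rewrite eqxx.
have [_ _ AB BA] := ve_split_notin.
have xG : x \in G.1 by rewrite (perm_mem (split_vertices spl)) inE mem_cat xA orbT.
have := eG x xG; rewrite ve_split_deg (ve_split_countB (AB _ xA)) ve_split_e0.
rewrite degE -cats1 count_cat /= /incident /= [c == x]eq_sym (negbTE xc).
have -> : (b == x) = false.
  by apply/eqP => bx; have := BA _ (split_b spl); rewrite inE bx xA orbT.
by rewrite !orbF !addn0 addnC.
Qed.

(** Vertices of [Cb] keep their degrees, and [a] gets degree 2, from [e0] and [ac]. *)
Lemma ve_split_eulerian2 : eulerian G -> eulerian G2.
Proof.
move=> eG; apply: (eulerian_but_one (c := c)) ve_split_wf2 _ => x.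
have [nac nbc nab] := ve_split_neq.
have [_ _ AB BA] := ve_split_notin.
rewrite !inE => /or3P[/eqP-> _|/eqP->|xB xc]; last 1 first.
- have xG : x \in G.1 by rewrite (perm_mem (split_vertices spl)) inE mem_cat xB !orbT.
  have := eG x xG; rewrite ve_split_deg (ve_split_countA (BA _ xB)) ve_split_e0.
  rewrite degE count_cat /= ve_split_e0 /incident /= [c == x]eq_sym (negbTE xc).
  have -> : (a == x) = false.
    by apply/eqP => ax; have := AB _ (split_a spl); rewrite inE ax xB orbT.
  by rewrite !addn0 addnC.
- rewrite degE count_cat /= ve_split_e0 /incident /= eqxx /=.
  by rewrite ve_split_countB // AB // (split_a spl).
- by rewrite eqxx.
Qed.

Lemma ve_split_hajos : hajos G1 -> hajos G2 -> hajos G.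
Proof.
move=> /hajosE h1 /hajosE h2; apply/hajosE => eG.
have [k1 d1 le1] := h1 (ve_split_eulerian1 eG).
have [k2 d2 le2] := h2 (ve_split_eulerian2 eG).
have [nac nbc nab] := ve_split_neq; have [cA cB AB BA] := ve_split_notin.
exists (k1 + k2).-1.
  apply: (@decomposable_perm (A ++ (e0 :: B))).
    apply: perm_map; rewrite perm_sym; apply: perm_trans (split_edges spl) _.
    by rewrite -cat1s perm_catCA.
  (* The edge [e0] belongs to the side of [B]; its end [a] is one of the two vertices that the sides
     may share. *)
  apply: (@decomposable_two_sum _ _ _ _ a c) => //.
  - move=> x; have [->|xa] := eqVneq x a => //=; have [->|xc] := eqVneq x c => //=.
    rewrite has_count => hA; have xA : x \in Ca.
      apply: contraTT hA => xA; rewrite ve_split_countA // inE negb_or xc //.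
    rewrite ve_split_e0 has_count ve_split_countB ?AB // orbF.
    rewrite eq_sym (negbTE xa) /= => /eqP bx.
    by have := AB _ xA; rewrite -bx inE (split_b spl) orbT.
  - apply: decomposable_perm d1; apply: perm_map; rewrite perm_rcons; exact: perm_refl.
  - apply: decomposable_perm d2; apply: perm_map.
    by rewrite /= -cat_rcons perm_catC /= perm_cons perm_rcons.
(* Both graphs contain [ac], hence need at least one cycle, and [.-1] is a true predecessor. *)
have k1p : 0 < k1.
  case: k1 d1 {le1} => // -[VL [/size0nil-> _]] /perm_size; rewrite size_map size_rcons //.
have k2p : 0 < k2.
  by case: k2 d2 {le2} => // -[VL [/size0nil-> _]] /perm_size; rewrite size_map size_cat addn2.
have sV := perm_size (split_vertices spl); have sE := perm_size (split_edges spl).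
have ndE : nd G.2 <= nd A + nd (e0 :: B).
  apply: leq_trans (nd_cat _ _); apply: nd_sub => x.
  rewrite (perm_mem (perm_map ukey (split_edges spl))) /= !map_cat inE !mem_cat /= inE.
  by rewrite orbCA.
have nd1 : nd A <= nd (rcons A (a, c)).
  by apply: nd_sub => x; rewrite map_rcons mem_rcons inE => ->; rewrite orbT.
(* In [G2] the edge [ac] forms a parallel class of its own, since [B] avoids [a] and [e0] ends in
   [b], not in [c]. *)
have nd2 : (nd (e0 :: B)).+1 <= nd (B ++ [:: e0; (a, c)]).
  rewrite -(@nd_cons (a, c)).
    by apply: nd_sub => x; rewrite map_cat mem_cat /= !inE orbA orbC [X in _ || X]orbC.
  apply/negP; rewrite inE => /orP[/eqP|/mapP[f fB]].
    rewrite (split_edge spl) => /ukey_eqP[[/esym /eqP]|[/eqP]]; first by rewrite (negbTE nbc).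
    by rewrite (negbTE nab).
  have [_ _ /(_ f fB)[/= f1 f2 _]] := split_wfB spl.
  have aB := AB _ (split_a spl).
  by move/esym/ukey_eqP => [] fE; move: f1 f2; rewrite fE /= (negbTE aB).
move: le1 le2 sV sE; rewrite /= !(size_cat, size_rcons) /= => le1 le2 sV sE.
by rewrite sV sE; lia.
Qed.

(** At [a] the edge [e0] counts once, so an even degree needs an edge [az] in [A], which is then the
    only one. If [z] were not [c], it would have degree 1 in [G]. *)
Lemma ve_split_one_edge : eulerian G -> size A <= 1 -> map ukey A = [:: ukey (a, c)].
Proof.
move=> eG; have [nac nbc nab] := ve_split_neq; have [cA cB AB BA] := ve_split_notin.
have inG x : x \in Ca -> x \in G.1.
  by move=> xA; rewrite (perm_mem (split_vertices spl)) inE mem_cat xA orbT.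
have aC := split_a spl; have := eG a (inG a aC).
rewrite ve_split_deg ve_split_e0 eqxx /= (ve_split_countB (AB _ aC)) addn0.
have [_ _ hA] := split_wfA spl; have dG := ve_split_deg; move: hA dG => /=.
case: A => [|e []] //= hA dG; rewrite addn0 negbK oddb => ae _.
have [z ez [zA za]] : exists2 z, ukey e = ukey (a, z) & z \in c :: Ca /\ z != a.
  have [e1 e2 ne] := hA e (mem_head _ _); case: e ae e1 e2 ne {hA dG} => x y /=.
  rewrite /incident /= => /orP[/eqP->|/eqP->] xV yV ne.
    by exists y => //; rewrite eq_sym.
  by exists x; rewrite // ukeyC.
have [<-|zc] := eqVneq z c; first by rewrite ez.
move: zA; rewrite inE (negbTE zc) /= => zA.
have := eG z (inG z zA); rewrite dG ve_split_e0 -[incident z e]incident_ukey ez incident_ukey.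
rewrite (ve_split_countB (AB _ zA)) /incident /= eqxx orbT [a == z]eq_sym (negbTE za).
have -> // : (b == z) = false.
by apply/eqP => bz; have := BA _ (split_b spl); rewrite bz inE zA orbT.
Qed.

End VeSplit.

(** Both sides reduce to single edges [ac] and [bc], so one cycle [abc] covers [G], and the bound
    only needs at least three vertices. *)
Lemma ve_split_triangle G a b c Ca Cb e0 A B :
  ve_split G a b c Ca Cb e0 A B -> size A <= 1 -> size B <= 1 -> hajos G.
Proof.
move=> spl sA sB; apply/hajosE => eG; exists 1.
  have eA := ve_split_one_edge spl eG sA.
  have eB := ve_split_one_edge (ve_split_sym spl) eG sB.
  have [nac nbc nab] := ve_split_neq spl.
  exists [:: [:: a; b; c]].
    by split=> //=; rewrite /simple_closed /= !inE negb_or nab nac nbc.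
  rewrite perm_sym; apply: perm_trans (perm_map ukey (split_edges spl)) _.
  rewrite /= map_cat eA eB (split_edge spl) /= perm_cons [ukey (c, a)]ukeyC.
  by apply/permP => P /=; lia.
have sV := perm_size (split_vertices spl).
have : 0 < size Ca by rewrite -has_predT; apply/hasP; exists a; rewrite ?(split_a spl).
have : 0 < size Cb by rewrite -has_predT; apply/hasP; exists b; rewrite ?(split_b spl).
by rewrite sV /= size_cat; have := nd_size G.2; lia.
Qed.

(** * From vertex-edge-separators to splits *)

Definition edges_in (E : seq (nat * nat)) (X : seq nat) :=
  [seq e <- E | (e.1 \in X) && (e.2 \in X)].

Lemma perm_rem_idx (T : eqType) (x0 : T) i s :
  i < size s -> perm_eq s (nth x0 s i :: rem_idx i s).
Proof.
move=> si; rewrite -{1}(cat_take_drop i s) (drop_nth x0) //.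
by rewrite -cat1s perm_catCA.
Qed.

(** Biconnectedness makes [G - c] connected, so the removal of [e0] can disconnect it only by
    separating [a] from [b]. Every other vertex is then reached from exactly one of them, and no
    remaining edge joins [Ca] to [Cb]. *)
Lemma ve_separator_split G c i a b Ca Cb :
  let vs := [seq x <- G.1 | x != c] in let es := rem_idx i G.2 in
  wf G -> ve_separator G c i -> ukey (nth (0, 0) G.2 i) = ukey (a, b) ->
  uniq Ca -> (forall x, x \in Ca <-> reach vs es a x) ->
  uniq Cb -> (forall x, x \in Cb <-> reach vs es b x) ->
  ve_split G a b c Ca Cb (nth (0, 0) G.2 i)
    (edges_in G.2 (c :: Ca)) (edges_in G.2 (c :: Cb)).
Proof.
move=> vs es [uV nV hE] [[_ bi] _ cV iE ncon] e0E uCa hCa uCb hCb.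
set e0 := nth (0, 0) G.2 i in e0E *.
have pE : perm_eq G.2 (e0 :: es) := perm_rem_idx (0, 0) iE.
have esE e : e \in es -> e \in G.2 by move=> h; rewrite (perm_mem pE) inE h orbT.
have vsE x : (x \in vs) = (x != c) && (x \in G.1) by rewrite mem_filter.
have conE x y : x \in vs -> y \in vs -> reach vs G.2 x y.
  have [->|xy] := eqVneq x y; first by move=> yv _; apply: reach_refl.
  by rewrite !vsE => /andP[xc xV] /andP[yc yV]; apply: bi.
have stepE y z : (y, z) \in G.2 \/ (z, y) \in G.2 ->
    ((y, z) \in es \/ (z, y) \in es) \/ ((y = a /\ z = b) \/ (y = b /\ z = a)).
  rewrite !(perm_mem pE) !inE => -[] /orP[/eqP e|]; [right|by left; left|right|by left; right].
    by move: e0E; rewrite -e => /ukey_eqP[] [-> ->]; [left | right].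
  by move: e0E; rewrite -e => /ukey_eqP[] [-> ->]; [right | left].
(* Otherwise every use of [e0] in a path of [G - c] could be replaced by a detour. The premises sit
   under the negation so that it also yields that [a] and [b] lie in [vs]: a false premise would
   make the implication hold. *)
have nab : ~ (a \in vs -> b \in vs -> reach vs es a b).
  move=> rab; apply: ncon => x y xv yv; elim: (conE x y xv yv); first exact: reach_refl.
  move=> {yv}y z xy IH zv /stepE[e|]; first exact: reach_step IH zv e.
  have [_ yv] := reach_mem xy.
  case=> -[ya zb]; subst; first exact: reach_trans IH (rab yv zv).
  exact: reach_trans IH (reach_sym (rab zv yv)).
have av : a \in vs by apply/negPn/negP => /negbTE na; apply: nab; rewrite na.
have bv : b \in vs by apply/negPn/negP => /negbTE nb; apply: nab; rewrite nb.
have {}nab : ~ reach vs es a b by move=> h; apply: nab.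
(* Along a path of [G - c] starting at [a], the side changes only when [e0] is traversed, and this
   ends in [a] or [b]. *)
have cover x : x \in vs -> (x \in Ca) || (x \in Cb).
  move=> xv; apply/orP; rewrite hCa hCb.
  elim: (conE a x av xv); first by left; apply: reach_refl.
  move=> y z _ IH zv /stepE[e|[[_ ->]|[_ ->]]].
  - by case: IH => h; [left | right]; apply: reach_step h zv e.
  - by right; apply: reach_refl.
  - by left; apply: reach_refl.
have Cav x : x \in Ca -> x \in vs by move/hCa/reach_mem => [].
have Cbv x : x \in Cb -> x \in vs by move/hCb/reach_mem => [].
have disj x : x \in Ca -> x \in Cb -> False.
  by move=> /hCa xa /hCb xb; apply: nab; apply: reach_trans xa (reach_sym xb).
have cCa : c \notin Ca by apply/negP => /Cav; rewrite vsE eqxx.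
have cCb : c \notin Cb by apply/negP => /Cbv; rewrite vsE eqxx.
have aCa : a \in Ca by apply/hCa; apply: reach_refl.
have bCb : b \in Cb by apply/hCb; apply: reach_refl.
have uVs : uniq (c :: Ca ++ Cb).
  rewrite /= mem_cat negb_or cCa cCb cat_uniq uCa uCb /= andbT.
  by apply/hasPn => x xb; apply/negP => xa; apply: disj xa xb.
have wf_in X : uniq (c :: X) -> wf (c :: X, edges_in G.2 (c :: X)).
  by move=> uX; split=> // e; rewrite mem_filter => /andP[/andP[e1 e2] /hE[]].
have e0A : (e0.1 \in c :: Ca) && (e0.2 \in c :: Ca) = false.
  have bN : b \in c :: Ca = false.
    rewrite inE; apply/negP => /orP[/eqP bc|ba]; last exact: disj ba bCb.
    by rewrite -bc bCb in cCb.
  by have [->|->] := ukey_eqP e0E; rewrite /= bN ?andbF.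
have e0B : (e0.1 \in c :: Cb) && (e0.2 \in c :: Cb) = false.
  have aN : a \in c :: Cb = false.
    rewrite inE; apply/negP => /orP[/eqP ac|ab]; last exact: disj aCa ab.
    by rewrite -ac aCa in cCa.
  by have [->|->] := ukey_eqP e0E; rewrite /= aN ?andbF.
split=> //.
- apply: uniq_perm => // x; rewrite inE mem_cat.
  have [->//|xc] /= := eqVneq x c.
  apply/idP/idP => [xV|/orP[/Cav|/Cbv]]; try by rewrite vsE => /andP[].
  by apply: cover; rewrite vsE xc.
- apply: (perm_trans pE); rewrite perm_cons.
  have pin X : (e0.1 \in c :: X) && (e0.2 \in c :: X) = false ->
      perm_eq (edges_in G.2 (c :: X)) (edges_in es (c :: X)).
    by move=> h; apply: perm_trans (perm_filter _ pE) _; rewrite /= h.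
  rewrite perm_sym; apply: perm_trans (perm_cat (pin _ e0A) (pin _ e0B)) _.
  (* An edge of [es] outside the side of [Ca] must lie in the side of [Cb], and conversely; the
     cases are according to which ends equal [c]. *)
  rewrite perm_sym -(perm_filterC (fun e => (e.1 \in c :: Ca) && (e.2 \in c :: Ca)) es) perm_cat2l.
  rewrite /edges_in; apply/permP => P; congr (count _ _).
  apply: eq_in_filter => -[x y] xyE /=; have [xV yV nxy] := hE _ (esE _ xyE).
  move: xV yV nxy => /= xV yV nxy; rewrite !inE.
  have xvE : x != c -> x \in vs by move=> xc; rewrite vsE xc.
  have yvE : y != c -> y \in vs by move=> yc; rewrite vsE yc.
  have [xc|xc] := eqVneq x c; have [yc|yc] := eqVneq y c => /=.
  + by rewrite xc yc eqxx in nxy.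
  + have := cover y (yvE yc); have := @disj y.
    by case: (y \in Ca); case: (y \in Cb) => // h; case: h.
  + have := cover x (xvE xc); have := @disj x; rewrite !andbT.
    by case: (x \in Ca); case: (x \in Cb) => // h; case: h.
  + have xy : reach vs es x y by apply: reach_step (reach_refl _ (xvE xc)) (yvE yc) _; left.
    have yA : (y \in Ca) = (x \in Ca).
      by apply/idP/idP => /hCa h; apply/hCa; apply: reach_trans h _ => //; apply: reach_sym.
    have yB : (y \in Cb) = (x \in Cb).
      by apply/idP/idP => /hCb h; apply/hCb; apply: reach_trans h _ => //; apply: reach_sym.
    rewrite yA yB !andbb; have := cover x (xvE xc); have := @disj x.
    by case: (x \in Ca); case: (x \in Cb) => // h; case: h.
- by apply: wf_in; rewrite /= cCa.
- by apply: wf_in; rewrite /= cCb.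
Qed.

(** * Cutting at a vertex *)

(** Each edge lies on one side and each vertex other than [w] has its whole degree there. The
    decompositions are put side by side; [w] is counted at most twice, and the extra unit is paid by
    the second [-1] in the sum of the two bounds. *)
Lemma hajos_cut V E (R : seq nat) w :
  wf (V, E) ->
  (forall e, e \in E -> (e.1 \in R) || (e.2 \in R) ->
    ((e.1 \in R) || (e.1 == w)) && ((e.2 \in R) || (e.2 == w))) ->
  let G1 := ([seq x <- V | (x \in R) || (x == w)],
             [seq e <- E | (e.1 \in R) || (e.2 \in R)]) in
  let G2 := ([seq x <- V | x \notin R],
             [seq e <- E | ~~ ((e.1 \in R) || (e.2 \in R))]) in
  wf G1 -> wf G2 -> hajos G1 -> hajos G2 -> hajos (V, E).
Proof.
move=> [uV _ _] clos G1 G2 w1 w2 hG1 hG2; apply/hajosE => eG.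
have degD x : deg (V, E) x = deg G1 x + deg G2 x.
  by rewrite !degE -count_cat; apply/permP; rewrite perm_sym perm_filterC.
have deg1 x : x \notin R -> x != w -> deg G1 x = 0.
  move=> xR xw; apply: (@count_incident0 (rcons R w)); last by rewrite mem_rcons inE negb_or xw.
  move=> e; rewrite mem_filter => /andP[eR /clos/(_ eR)/andP[]].
  by rewrite !mem_rcons !inE ![_ || (_ == w)]orbC.
have deg2 x : x \in R -> deg G2 x = 0.
  move=> xR; apply: (@count_incident0 [seq y <- V | y \notin R]); last first.
    by rewrite mem_filter xR.
  by move=> e eE; have [_ _ /(_ e eE)[]] := w2.
have e1 : eulerian G1.
  apply: (eulerian_but_one (c := w)) w1 _ => x; rewrite mem_filter => /andP[+ xV] xw.
  by rewrite (negbTE xw) orbF => xR; have := eG x xV; rewrite degD (deg2 _ xR) addn0.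
have e2 : eulerian G2.
  apply: (eulerian_but_one (c := w)) w2 _ => x; rewrite mem_filter => /andP[xR xV] xw.
  by have := eG x xV; rewrite degD deg1.
have [k1 d1 le1] := (hajosE G1).1 hG1 e1; have [k2 d2 le2] := (hajosE G2).1 hG2 e2.
have pE : perm_eq (G1.2 ++ G2.2) E by apply/permPl; apply: perm_filterC.
exists (k1 + k2).
  by apply: decomposable_perm (decomposable_cat d1 d2); apply: perm_map.
have ndE : nd E <= nd G1.2 + nd G2.2.
  apply: leq_trans (nd_cat _ _); apply: nd_sub => x.
  by rewrite (perm_mem (perm_map ukey pE)).
have sE := perm_size pE; rewrite size_cat in sE.
have sV : size G1.1 + size G2.1 <= (size V).+1.
  rewrite /= !size_filter -(count_predC (fun x => x \in R) V) -addSn.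
  rewrite -[X in _ <= X + _]addn1 leq_add2r.
  apply: leq_trans (_ : count (mem R) V + count_mem w V <= _).
    by rewrite -count_predUI -[X in X <= _]addn0 leq_add // sub_count.
  by rewrite leq_add2l count_uniq_mem // leq_b1.
by move: le1 le2 => /=; rewrite -sE; move: sV ndE => /=; lia.
Qed.

(** * Sequences of splits and merges *)

Lemma hajos_cyc3 L : cyc3 L -> hajos (forget L).
Proof.
move=> [[cs [vl [cyc pcs pvl]]] s3] _; exists [:: cs]; split.
  split; first by rewrite /= cats0.
  by move=> ds; rewrite inE => /eqP->; exists vl.
by rewrite /= muln1; apply: leq_trans s3 (leq_addr _ _).
Qed.

Lemma map_fst_induced L X : map fst (induced L X) = edges_in (forget L).2 X.
Proof. by rewrite /induced /edges_in filter_map. Qed.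

Lemma split_at_ve_split L k L1 L2 : wf (forget L) -> split_at L k L1 L2 ->
  exists a b c Ca Cb e0 A B,
    [/\ ve_split (forget L) a b c Ca Cb e0 A B,
        forget L1 = (c :: Ca, rcons A (a, c)) &
        forget L2 = (a :: c :: Cb, B ++ [:: e0; (a, c)])].
Proof.
move=> wL [_ [_ [c [i [a [b [t [Ca [Cb [sep [nthE [[uCa hCa] [[uCb hCb] [_ [-> ->]]]]]]]]]]]]]]].
have iL : i < size L.2 by have [_ _ _] := sep; rewrite size_map.
have nE : (nth ((0, 0), 0) L.2 i).1 = nth (0, 0) (forget L).2 i by rewrite (nth_map ((0, 0), 0)).
have e0E : ukey (nth (0, 0) (forget L).2 i) = ukey (a, b).
  by rewrite -nE; case: nthE => ->; rewrite //= ukeyC.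
exists a, b, c, Ca, Cb, (nth (0, 0) (forget L).2 i).
exists (edges_in (forget L).2 (c :: Ca)), (edges_in (forget L).2 (c :: Cb)).
split.
- exact: ve_separator_split.
- by rewrite /forget /= map_rcons map_fst_induced.
- by rewrite /forget /= map_cat map_fst_induced /= nE.
Qed.

(** The conjecture is pulled back through the splits one at a time; well-formedness is carried
    forward because each such step relies on it. *)
Lemma split_star_hajos G S : wf G -> star split_step (init_state G) S ->
  (forall L, L \in S -> wf (forget L)) /\
  ((forall L, L \in S -> hajos (forget L)) -> hajos G).
Proof.
move=> wG; elim=> [|S1 S2 _ [wS1 hS1] [L [rest [k [L1 [L2 [pS _ spl ->]]]]]]].
  have fE : forget (G.1, [seq (e, 0) | e <- G.2]) = G.
    by case: G {wG} => V E; rewrite /forget /= -map_comp map_id.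
  split=> [L|h]; first by rewrite inE => /eqP->; rewrite fE.
  by rewrite -fE; apply: h; rewrite mem_head.
have LS : L \in S1 by rewrite (perm_mem pS) mem_head.
have restS M : M \in rest -> M \in S1 by move=> h; rewrite (perm_mem pS) inE h orbT.
have [a [b [c [Ca [Cb [e0 [A [B [vspl f1 f2]]]]]]]]] := split_at_ve_split (wS1 _ LS) spl.
split=> [M|hS2].
  rewrite !inE => /or3P[/eqP->|/eqP->|/restS/wS1//].
  - by rewrite f1; apply: ve_split_wf1 vspl.
  - by rewrite f2; apply: ve_split_wf2 vspl.
apply: hS1 => M; rewrite (perm_mem pS) inE => /orP[/eqP->|Mr].
  apply: (ve_split_hajos vspl); rewrite -?f1 -?f2; apply: hS2.
  - exact: mem_head.
  - by rewrite !inE eqxx orbT.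
by apply: hS2; rewrite !inE Mr !orbT.
Qed.

(** Undoing a merge restores two cycles of length at least 3, which satisfy the conjecture outright;
    all other graphs are unchanged. *)
Lemma merge_star_hajos S T : star merge_step S T ->
  (forall L, L \in T -> hajos (forget L)) -> forall L, L \in S -> hajos (forget L).
Proof.
elim=> // T1 T2 _ IH [L1 [L2 [L3 [rest [pT [c1 [c2 _]] ->]]]]] hT2; apply: IH => M.
rewrite (perm_mem pT) !inE => /or3P[/eqP->|/eqP->|Mr]; try exact: hajos_cyc3.
by apply: hT2; rewrite inE Mr orbT.
Qed.

(** * Reduction to 2.5-connected graphs *)

(** [R] is a component of [G], or of [G - w] for a cut vertex [w]. The vertex [v] is missing from
    one side of the cut and [u] from the other, so both sides are smaller. *)
Lemma hajos_nonbiconnected G :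
  wf G -> ~ biconnected G ->
  (forall H, wf H -> size H.1 + size H.2 < size G.1 + size G.2 -> hajos H) -> hajos G.
Proof.
case: G => V E wG nbi IH; have [/= uV _ hE] := wG.
have [R [w [u [v [clos [uV' uR] [vV vR vw]]]]]] : exists (R : seq nat) w u v,
    [/\ forall e, e \in E -> (e.1 \in R) || (e.2 \in R) ->
          ((e.1 \in R) || (e.1 == w)) && ((e.2 \in R) || (e.2 == w)),
        u \in V /\ u \in R & [/\ v \in V, v \notin R & v != w]].
  have [con|] := classic (connected V E); last first.
    move/not_all_ex_not => [x] /not_all_ex_not[y] h.
    have [xV h1] := imply_to_and _ _ h; have [yV nxy] := imply_to_and _ _ h1.
    have [R [_ hR]] := reach_set V E x.
    have xR : x \in R by apply/hR; apply: reach_refl.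
    (* Here the cut vertex [w] is a dummy: [x] lies in [R], so the two sides are disjoint. *)
    exists R, x, x, y; split=> //; last first.
      split=> //; first by apply/negP => /hR.
      by apply/eqP => yx; apply: nxy; rewrite yx; apply: reach_refl.
    case=> p q pqE /= pq; have [/= pV qV _] := hE _ pqE.
    by case/orP: pq => /hR h'; apply/andP; split; apply/orP; left; apply/hR => //;
      apply: reach_step h' _ _ => //; [left | right].
  have [u [v [w [uV' vV wV [uv uw vw] nr]]]] : exists u v w,
      [/\ u \in V, v \in V, w \in V, [/\ u != v, u != w & v != w] &
          ~ reach [seq x <- V | x != w] E u v].
    apply: NNPP => no; apply: nbi; split=> // u v w /= uV' vV wV uv uw vw.
    by apply: NNPP => nr; apply: no; exists u, v, w.
  have [R [_ hR]] := reach_set [seq x <- V | x != w] E u.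
  have uR : u \in R by apply/hR; apply: reach_refl; rewrite mem_filter uw.
  exists R, w, u, v; split=> //; last by split=> //; apply/negP => /hR.
  case=> p q pqE /= pq; have [/= pV qV _] := hE _ pqE.
  have wR : w \in R = false by apply/negP => /hR /reach_mem[_]; rewrite mem_filter eqxx.
  move: pq; have [->|pw] := eqVneq p w; have [->|qw] := eqVneq q w;
    rewrite ?wR ?orbT ?orbF ?andbT //=.
  by case/orP=> /hR h'; apply/andP; split; apply/hR => //;
    apply: reach_step h' _ _; rewrite ?mem_filter ?pw ?qw //; [left | right].
have filt_lt (P : pred nat) x : x \in V -> ~~ P x -> size (filter P V) < size V.
  move=> xV nP; rewrite size_filter -(count_predC P V) -[X in X < _]addn0 ltn_add2l -has_count.
  by apply/hasP; exists x.
have filt_le (P : pred (nat * nat)) : size (filter P E) <= size E.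
  by rewrite size_filter count_size.
have w1 : wf ([seq x <- V | (x \in R) || (x == w)],
             [seq e <- E | (e.1 \in R) || (e.2 \in R)]).
  split=> /=; first exact: filter_uniq.
  - by rewrite -has_filter; apply/hasP; exists u => //=; rewrite uR.
  move=> e; rewrite mem_filter => /andP[eR eE]; have [e1 e2 ne] := hE _ eE.
  by have /andP[c1 c2] := clos _ eE eR; rewrite !mem_filter c1 c2 e1 e2.
have w2 : wf ([seq x <- V | x \notin R],
             [seq e <- E | ~~ ((e.1 \in R) || (e.2 \in R))]).
  split=> /=; first exact: filter_uniq.
  - by rewrite -has_filter; apply/hasP; exists v.
  move=> e; rewrite mem_filter negb_or => /andP[/andP[r1 r2] eE].
  by have [e1 e2 ne] := hE _ eE; rewrite !mem_filter r1 r2 e1 e2.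
apply: (hajos_cut wG clos w1 w2); apply: IH => //=; rewrite -addSn leq_add ?filt_le //.
  by apply: (filt_lt _ v) => //; rewrite negb_or vR.
by apply: (filt_lt _ u) => //; rewrite negbK.
Qed.

Lemma hajos_reduction : (forall G, wf G -> two5_connected G -> hajos G) ->
  forall G, wf G -> hajos G.
Proof.
move=> h25 G; have [n] := ubnP (size G.1 + size G.2).
elim: n G => // n IHn G; rewrite ltnS => sG wG.
have IH H : wf H -> size H.1 + size H.2 < size G.1 + size G.2 -> hajos H.
  by move=> wH sH; apply: IHn => //; apply: leq_trans sH sG.
have [bi|nbi] := classic (biconnected G); last exact: hajos_nonbiconnected IH.
have [|nsep] := classic (exists c i, ve_separator G c i); last first.
  by apply: h25 => //; split=> // c i sep; apply: nsep; exists c, i.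
case=> c [i sep]; case e0E : (nth (0, 0) G.2 i) => [a b].
have [Ca [uCa hCa]] := reach_set [seq x <- G.1 | x != c] (rem_idx i G.2) a.
have [Cb [uCb hCb]] := reach_set [seq x <- G.1 | x != c] (rem_idx i G.2) b.
have := ve_separator_split wG sep (congr1 ukey e0E) uCa hCa uCb hCb.
set A := edges_in _ (c :: Ca); set B := edges_in _ (c :: Cb) => spl.
(* The second graph has [|Cb| + |B| + 4] vertices and edges, against [|Ca| + |Cb| + |A| + |B| + 2]
   in [G]; two edges in [A] make it smaller. *)
have key a' b' Ca' Cb' A' B' : ve_split G a' b' c Ca' Cb' (nth (0, 0) G.2 i) A' B' ->
    1 < size A' -> hajos G.
  move=> spl' sA.
  have sV := perm_size (split_vertices spl'); have sE := perm_size (split_edges spl').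
  have pa : 0 < size Ca' by rewrite -has_predT; apply/hasP; exists a'; rewrite ?(split_a spl').
  have pb : 0 < size Cb' by rewrite -has_predT; apply/hasP; exists b'; rewrite ?(split_b spl').
  move: sV sE; rewrite /= !size_cat => sV sE.
  apply: (ve_split_hajos spl'); apply: IH; rewrite ?sV ?sE /= ?size_rcons ?size_cat /=; try lia.
  - exact: ve_split_wf1 spl'.
  - exact: ve_split_wf2 spl'.
have [sA|sA] := ltnP 1 (size A); first exact: key spl sA.
have [sB|sB] := ltnP 1 (size B); first exact: key (ve_split_sym spl) sB.
exact: ve_split_triangle spl sA sB.
Qed.

Theorem theorem11 :
  (forall (G : graph) (F : seq graph),
     wf G -> biconnected G -> two5_components G F ->
     (forall H, H \in F -> hajos H) -> hajos G) /\
  ((forall G : graph, wf G -> hajos G) <->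
   (forall G : graph, wf G -> two5_connected G -> hajos G)).
Proof.
split=> [G F wG _ [S [T [spl _ mrg _ ->]]] hF|].
  have [_] := split_star_hajos wG spl; apply; apply: (merge_star_hajos mrg) => L LT.
  by apply: hF; apply: map_f.
by split=> [h G wG _|]; [apply: h | apply: hajos_reduction].
Qed.
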